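(* For a positive integer $n$, the empty graph $\overline{K}_n$ is extendable if and only if $n$ is even.
   Context: All graphs are finite, simple, undirected, without loops. $\overline{K}_n$ is the graph on $n$ vertices with no edges. The Seidel matrix of a graph $G$ is $S(G)=\mathbf{J}-\mathbf{I}-2A(G)$, where $A(G)$ is the adjacency matrix, $\mathbf{J}$ the all-ones matrix and $\mathbf{I}$ the identity matrix; equivalently, a Seidel matrix is a symmetric matrix with zero diagonal and all off-diagonal entries $\pm1$. A Seidel matrix $S$ with largest eigenvalue $\lambda$ is extendable if there is a Seidel matrix $S'$ such that the largest eigenvalue of $S'$ equals $\lambda$ and $S'$ contains $S$ as a proper principal submatrix. A graph $G$ is extendable if $S(G)$ is. *)

(* Defs.v *)
From mathcomp Require Import all_boot all_order all_algebra.

Set Implicit Arguments.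
Unset Strict Implicit.
Unset Printing Implicit Defensive.

Import Order.TTheory GRing.Theory Num.Theory.
Local Open Scope ring_scope.

Record sgraph (n : nat) := SGraph {
  adj : rel 'I_n;
  adj_sym : symmetric adj;
  adj_irr : irreflexive adj }.

Definition empty_graph (n : nat) : sgraph n :=
  @SGraph n (fun _ _ => false) (fun _ _ => erefl) (fun _ => erefl).

Definition adjacency_mx (R : rcfType) (n : nat) (G : sgraph n) : 'M[R]_n :=
  \matrix_(i, j) (adj G i j)%:R.

Definition seidel_mx (R : rcfType) (n : nat) (G : sgraph n) : 'M[R]_n :=
  const_mx 1 - 1%:M - 2%:R *: adjacency_mx R G.

Definition is_seidel (R : rcfType) (n : nat) (S : 'M[R]_n) : Prop :=
  [/\ S^T = S,
      forall i, S i i = 0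
    & forall i j, i != j -> S i j = 1 \/ S i j = -1].

Lemma seidel_mxP (R : rcfType) (n : nat) (G : sgraph n) :
  is_seidel (seidel_mx R G).
Proof.
split.
- apply/matrixP => i j; rewrite !mxE adj_sym (eq_sym j i) //.
- by move=> i; rewrite !mxE adj_irr eqxx mulr0 subr0 subrr.
- move=> i j /negPf nij; rewrite !mxE nij subr0.
  case: (adj G i j); last by left; rewrite mulr0 subr0.
  by right; rewrite mulr1 mulr2n opprD addrA subrr sub0r.
Qed.

Definition is_largest_eigenvalue (R : rcfType) (n : nat) (S : 'M[R]_n)
    (lambda : R) : Prop :=
  eigenvalue S lambda /\ forall mu : R, eigenvalue S mu -> mu <= lambda.

(* The injection f lists the selected indices in any order, so submatrices
   are taken up to simultaneous permutation of rows and columns. *)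
Definition proper_principal_submx (R : rcfType) (n m : nat)
    (S : 'M[R]_n) (S' : 'M[R]_m) : Prop :=
  (n < m)%N /\ exists f : 'I_n -> 'I_m, injective f /\ S = mxsub f f S'.

Definition extendable_mx (R : rcfType) (n : nat) (S : 'M[R]_n) : Prop :=
  exists lambda : R, is_largest_eigenvalue S lambda /\
    exists (m : nat) (S' : 'M[R]_m),
      [/\ is_seidel S', is_largest_eigenvalue S' lambda
        & proper_principal_submx S S'].

Definition extendable (R : rcfType) (n : nat) (G : sgraph n) : Prop :=
  extendable_mx (seidel_mx R G).

(* Main.v *)
Require Import Defs.
From mathcomp Require Import all_boot all_order all_algebra.
From mathcomp Require Import complex ring lra.

(** The Seidel matrix of the empty graph on n vertices is J - I, with J the
    all-ones matrix, and its largest eigenvalue is n - 1, with eigenvector the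
    all-ones vector.

    For even n, border J - I by a row x of n / 2 entries 1 and n / 2 entries
    -1, for instance the alternating signs.  Since x is orthogonal to the
    all-ones vector, bordering keeps n - 1 as an eigenvalue, and pairing an
    eigenvector equation with x and with the all-ones vector shows that no
    larger eigenvalue appears ([border_eigenvalue_le]).

    For odd n, let S' be a Seidel matrix with largest eigenvalue n - 1 that
    contains J - I on a proper subset of the indices, and let v be the
    indicator row of that subset.  The Rayleigh quotient of S' at v is that of
    J - I at the all-ones vector, namely n - 1.  A vector at which the Rayleigh
    quotient of a symmetric matrix reaches an upper bound of the spectrum is an
    eigenvector ([rayleigh_eq_eigenvector]), so v S' = (n - 1) v.  At an index
    outside the subset this says that a sum of n entries equal to 1 or -1
    vanishes, which parity forbids ([sum_pm1_eq0_even]). *)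

Set Implicit Arguments.
Unset Strict Implicit.
Unset Printing Implicit Defensive.

Import Order.TTheory GRing.Theory Num.Theory.
Local Open Scope ring_scope.

(** * Equality in the Rayleigh bound *)

Section HermitianRayleigh.

Local Open Scope sesquilinear_scope.

(** In an orthonormal eigenbasis the equality reads as the vanishing of the
    sum of the terms (l - d_k) |w_k|^2, all nonnegative; hence each
    coordinate w_k with d_k < l is zero. *)
Lemma hermitian_rayleigh_eq (C : numClosedFieldType) (m : nat) (A : 'M[C]_m)
    (l : C) (v : 'rV[C]_m) :
    A \is hermsymmx -> (forall k, spectral_diag A 0 k <= l) ->
    v *m A *m v ^t* = l *: (v *m v ^t*) ->
  v *m A = l *: v.
Proof.
move=> hermA le_l.
have /orthomx_spectralP := hermitian_normalmx hermA.
have unitP := spectral_unitarymx A.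
move: (spectralmx A) (spectral_diag A) le_l unitP => P d le_l unitP eqA.
have [w ->] : exists w : 'rV[C]_m, v = w *m P.
  by exists (v *m invmx P); rewrite mulmxKV ?unitarymx_unit.
have PPt : P *m P ^t* = 1%:M by apply/unitarymxP.
have formP (B : 'M[C]_m) :
    w *m P *m (P ^t* *m B *m P) *m (w *m P) ^t* = w *m B *m w ^t*.
  rewrite trmx_mul map_mxM !mulmxA -(mulmxA w P) PPt mulmx1.
  by rewrite -(mulmxA (w *m B)) PPt mulmx1.
have eqwA : w *m P *m A = w *m diag_mx d *m P.
  by rewrite eqA !mulmxA mulmxK ?unitarymx_unit.
have -> : w *m P *m (w *m P) ^t* = w *m w ^t*.
  by rewrite trmx_mul map_mxM mulmxA -(mulmxA w) PPt mulmx1.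
rewrite {1}eqA invmx_unitary // formP eqwA scalemxAl => eq_form.
have terms0 : \sum_k (l - d 0 k) * `|w 0 k| ^+ 2 = 0.
  have /matrixP/(_ 0 0) := eq_form.
  rewrite mul_mx_diag !mxE => eq_sum.
  apply/eqP; move/eqP: eq_sum; rewrite eq_sym -subr_eq0 -sumrB.
  congr (_ == _); apply: eq_bigr => k _; rewrite !mxE normCK; ring.
rewrite scalemxAl; congr (_ *m P); apply/rowP => k; rewrite mul_mx_diag !mxE.
have ge0 i : true -> 0 <= (l - d 0 i) * `|w 0 i| ^+ 2.
  by rewrite mulr_ge0 ?exprn_ge0 // subr_ge0.
have /eqP := psumr_eq0P ge0 terms0 (i := k) isT.
rewrite mulf_eq0 subr_eq0 expf_eq0 normr_eq0 /= => /orP[] /eqP ->.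
  exact: mulrC.
by rewrite mul0r mulr0.
Qed.

Lemma spectral_diag_eigenvalue (C : numClosedFieldType) (m : nat)
    (A : 'M[C]_m) (k : 'I_m) :
  A \is normalmx -> eigenvalue A (spectral_diag A 0 k).
Proof.
move=> /orthomx_spectralP; have := spectral_unit A.
move: (spectralmx A) (spectral_diag A) => P d unitP eqA.
apply/eigenvalueP; exists (row k P); last first.
  apply: contraTneq unitP => /rowP row0.
  rewrite unitmxE (expand_det_row _ k) big1 ?unitr0 // => j _.
  by have := row0 j; rewrite !mxE => ->; rewrite mul0r.
rewrite -row_mul eqA !mulmxA mulmxV // mul1mx mul_diag_mx.
by apply/rowP => j; rewrite !mxE.
Qed.

End HermitianRayleigh.

(** The hermitian statement, read over R[i]: the eigenvalues of S over R[i] are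
    real, hence already eigenvalues over R. *)
Lemma rayleigh_eq_eigenvector (R : rcfType) (m : nat) (S : 'M[R]_m) (l : R)
    (v : 'rV[R]_m) :
    S^T = S -> (forall mu, eigenvalue S mu -> mu <= l) ->
    v *m S *m v^T = l *: (v *m v^T) ->
  v *m S = l *: v.
Proof.
move=> symS le_l eq_form.
pose f := [the {rmorphism R -> R[i]} of real_complex R].
have real_f x : f x \is Num.real by apply/complex_realP; exists x.
have realS : map_mx f S \is a mxOver Num.real.
  by apply/mxOverP => i j; rewrite mxE real_f.
have conj_f p q (B : 'M[R]_(p, q)) : map_mx Num.conj (map_mx f B) = map_mx f B.
  by apply/matrixP => i j; rewrite !mxE conj_Creal.
have hermS : map_mx f S \is hermsymmx.
  apply: realsym_hermsym => //.
  by apply/is_hermitianmxP; rewrite expr0 scale1r map_mx_id // map_trmx symS.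
apply: (@map_mx_inj _ _ f); rewrite map_mxM map_mxZ.
apply: hermitian_rayleigh_eq => //; last first.
  by rewrite map_trmx conj_f -!map_mxM -map_mxZ eq_form.
move=> k; set d := spectral_diag _ 0 k.
have /complex_realP[mu def_d] : d \is Num.real.
  by have /mxOverP := hermitian_spectral_diag_real hermS; apply.
rewrite def_d lecR; apply: le_l.
rewrite -(eigenvalue_map f) /= -def_d.
exact/spectral_diag_eigenvalue/hermitian_normalmx.
Qed.

(** * The spectrum of the empty graph *)

Lemma seidel_emptyE (R : rcfType) (n : nat) :
  seidel_mx R (empty_graph n) = const_mx 1 - 1%:M.
Proof. by apply/matrixP => i j; rewrite !mxE mulr0 subr0. Qed.

Lemma mulmx_seidel_empty (R : rcfType) (n : nat) (u : 'rV[R]_n) :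
  u *m seidel_mx R (empty_graph n) = const_mx (\sum_i u 0 i) - u.
Proof.
rewrite seidel_emptyE mulmxBr mulmx1; congr (_ - _); apply/rowP => j.
by rewrite !mxE; apply: eq_bigr => i _; rewrite mxE mulr1.
Qed.

(** Summing the coordinates of an eigenvector equation for mu gives
    (n - 1) s = mu s, with s the sum of the coordinates. *)
Lemma largest_eigenvalue_empty (R : rcfType) (n : nat) :
  (0 < n)%N ->
  is_largest_eigenvalue (seidel_mx R (empty_graph n)) (n%:R - 1).
Proof.
move=> n_gt0; split.
  apply/eigenvalueP; exists (const_mx 1).
    rewrite mulmx_seidel_empty; apply/rowP => j; rewrite !mxE mulr1.
    by under eq_bigr do rewrite mxE; rewrite sumr_const card_ord.
  apply/eqP => /rowP/(_ (Ordinal n_gt0)); rewrite !mxE => /eqP.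
  by rewrite oner_eq0.
move=> mu /eigenvalueP[u]; rewrite mulmx_seidel_empty.
set s := \sum_i u 0 i => /rowP eq_u u_neq0.
have coord j : s - u 0 j = mu * u 0 j by have := eq_u j; rewrite !mxE.
have total : s * (n%:R - 1 - mu) = 0.
  have : \sum_j (s - u 0 j) = \sum_j mu * u 0 j by apply: eq_bigr.
  rewrite sumrB sumr_const card_ord -mulr_sumr -/s -mulr_natr; lra.
have [s0|s_neq0] := eqVneq s 0; last first.
  move/eqP: total; rewrite mulf_eq0 (negPf s_neq0) /= subr_eq0.
  by move=> /eqP ->.
have /rV0Pn[j uj_neq0] := u_neq0.
have -> : mu = -1.
  by apply: (mulIf uj_neq0); rewrite -coord s0 sub0r mulN1r.
by have : 1 <= n%:R :> R; [rewrite ler1n | lra].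
Qed.

(** * Even order: bordering by a balanced row of signs *)

Definition border (R : rcfType) (n : nat) (S : 'M[R]_n) (x : 'rV[R]_n) :
    'M[R]_(n + 1) :=
  block_mx S x^T x 0.

Lemma border_is_seidel (R : rcfType) (n : nat) (S : 'M[R]_n) (x : 'rV[R]_n) :
    is_seidel S -> (forall i, x 0 i = 1 \/ x 0 i = -1) ->
  is_seidel (border S x).
Proof.
move=> [symS diagS offS] signx; split.
- by rewrite /border tr_block_mx symS trmxK trmx0.
- move=> i; rewrite /border; case: (split_ordP i) => k ->.
    by rewrite block_mxEul diagS.
  by rewrite block_mxEdr mxE.
move=> i j; rewrite /border.
case: (split_ordP i) => k ->; case: (split_ordP j) => l ->.
- by rewrite block_mxEul (inj_eq (@lshift_inj _ _)); apply: offS.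
- by rewrite block_mxEur mxE (ord1 l).
- by rewrite block_mxEdl (ord1 k).
by rewrite (ord1 k) (ord1 l) eqxx.
Qed.

Lemma border_eigenvalue (R : rcfType) (n : nat) (x : 'rV[R]_n) :
    (0 < n)%N -> \sum_i x 0 i = 0 ->
  eigenvalue (border (seidel_mx R (empty_graph n)) x) (n%:R - 1).
Proof.
move=> n_gt0 sumx; apply/eigenvalueP; exists (row_mx (const_mx 1) 0).
  rewrite /border mul_row_block !mul0mx !addr0 scale_row_mx scaler0.
  congr row_mx.
    rewrite mulmx_seidel_empty; apply/rowP => j; rewrite !mxE mulr1.
    by under eq_bigr do rewrite mxE; rewrite sumr_const card_ord.
  apply/rowP => j; rewrite !mxE -[RHS]sumx.
  by apply: eq_bigr => i _; rewrite !mxE mul1r ord1.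
apply/eqP => /rowP/(_ (lshift 1 (Ordinal n_gt0))).
by rewrite row_mxEl !mxE => /eqP; rewrite oner_eq0.
Qed.

(** Let (u, t) be an eigenvector for mu.  Pairing its first block with the
    all-ones row gives (n - 1) s = mu s for the sum s of the coordinates of u,
    and pairing it with x gives n t = mu (mu + 1) t, because x is balanced.
    Since n - 1 >= 1, a value mu > n - 1 satisfies mu (mu + 1) > n, so it
    forces s = t = 0, and then -u = mu u. *)
Lemma border_eigenvalue_le (R : rcfType) (n : nat) (x : 'rV[R]_n) (mu : R) :
    (1 < n)%N -> \sum_i x 0 i = 0 -> (forall i, x 0 i ^+ 2 = 1) ->
    eigenvalue (border (seidel_mx R (empty_graph n)) x) mu ->
  mu <= n%:R - 1.
Proof.
move=> n_gt1 sumx sqrx /eigenvalueP[w]; rewrite -[w]hsubmxK.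
move: (lsubmx w) (rsubmx w) => u T; rewrite [T]mx11_scalar.
move: (T 0 0) => t.
rewrite /border mul_row_block mulmx0 addr0 mul_scalar_mx mulmx_seidel_empty.
rewrite scale_row_mx => /eq_row_mx[/rowP eq_u /rowP/(_ 0)].
set s := \sum_i u 0 i in eq_u *.
rewrite !mxE eqxx mulr1n => eq_t w_neq0.
have coord j : s - u 0 j + t * x 0 j = mu * u 0 j.
  by have := eq_u j; rewrite !mxE.
have {}eq_t : \sum_j u 0 j * x 0 j = mu * t.
  by rewrite -eq_t; apply: eq_bigr => j _; rewrite mxE.
have sum_ones : (n%:R - 1 - mu) * s = 0.
  have : \sum_j (s - u 0 j + t * x 0 j) = \sum_j mu * u 0 j.
    exact: eq_bigr.
  rewrite big_split sumrB sumr_const card_ord -!mulr_sumr sumx -/s -mulr_natr.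
  by move=> /= eq_s; lra.
have sum_x : (mu * (mu + 1) - n%:R) * t = 0.
  have : \sum_j (s - u 0 j + t * x 0 j) * x 0 j = \sum_j mu * (u 0 j * x 0 j).
    by apply: eq_bigr => j _; rewrite coord mulrA.
  rewrite -mulr_sumr eq_t.
  under eq_bigr do rewrite mulrDl mulrBl -mulrA -expr2 sqrx mulr1.
  rewrite big_split sumrB sumr_const card_ord -mulr_sumr sumx eq_t -mulr_natr.
  by move=> /= eq_s; lra.
have n_ge2 : 2 <= n%:R :> R by rewrite ler_nat.
rewrite leNgt; apply: contraNN w_neq0 => lt_mu.
have s0 : s = 0.
  have neq0 : n%:R - 1 - mu != 0 by apply/eqP; lra.
  by move/eqP: sum_ones; rewrite mulf_eq0 (negPf neq0) => /eqP.
have t0 : t = 0.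
  have neq0 : mu * (mu + 1) - n%:R != 0 by apply/eqP; nra.
  by move/eqP: sum_x; rewrite mulf_eq0 (negPf neq0) => /eqP.
have u0 : u = 0.
  apply/rowP => j; rewrite mxE.
  have neq0 : mu + 1 != 0 by apply/eqP; lra.
  by apply: (mulfI neq0); have := coord j; rewrite s0 t0; lra.
by rewrite u0 t0 raddf0 row_mx0.
Qed.

Lemma sum_alternating_signs (R : rcfType) (n : nat) :
  ~~ odd n -> \sum_(i < n) (-1) ^+ i = 0 :> R.
Proof.
move=> /even_halfK <-; elim: n./2 => [|k IHk]; first by rewrite big_ord0.
by rewrite doubleS !big_ord_recr /= IHk add0r exprS mulN1r subrr.
Qed.

Lemma even_extendable (R : rcfType) (n : nat) :
  (0 < n)%N -> ~~ odd n -> extendable R (empty_graph n).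
Proof.
move=> n_gt0 even_n; have n_gt1 : (1 < n)%N by case: n n_gt0 even_n => [|[]].
pose x : 'rV[R]_n := \row_i (-1) ^+ i.
have sumx : \sum_i x 0 i = 0.
  by under eq_bigr do rewrite mxE; exact: sum_alternating_signs.
exists (n%:R - 1); split; first exact: largest_eigenvalue_empty.
exists (n + 1)%N, (border (seidel_mx R (empty_graph n)) x); split.
- apply: border_is_seidel; first exact: seidel_mxP.
  by move=> i; rewrite mxE -signr_odd; case: odd; [right | left].
- split=> [|mu]; first exact: border_eigenvalue.
  by apply: border_eigenvalue_le => // i; rewrite mxE sqrr_sign.
split; first by rewrite addn1.
exists (lshift 1); split; first exact: lshift_inj.
by apply/matrixP => i j; rewrite [RHS]mxE block_mxEul.
Qed.

(** * Odd order: parity of a row of signs *)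

(** With b entries equal to -1, the sum is n - 2 b. *)
Lemma sum_pm1_eq0_even (R : rcfType) (n : nat) (F : 'I_n -> R) :
    (forall i, F i = 1 \/ F i = -1) -> \sum_i F i = 0 ->
  ~~ odd n.
Proof.
move=> signF sumF.
have eqF i : F i = 1 - (F i == -1)%:R *+ 2.
  case: (signF i) => ->; last by rewrite eqxx /=; lra.
  by rewrite (_ : (1 == -1 :> R) = false) ?mul0rn ?subr0 //; apply/eqP; lra.
have : n%:R = ((\sum_i (F i == -1%R)) .*2)%:R :> R.
  apply/eqP; rewrite -subr_eq0 -[X in _ == X]sumF (eq_bigr _ (fun i _ => eqF i)).
  by rewrite sumrB sumr_const card_ord sumrMnl -mul2n natrM natr_sum mulr_natl.
by move=> /eqP; rewrite eqr_nat => /eqP ->; rewrite odd_double.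
Qed.

Lemma extendable_even (R : rcfType) (n : nat) :
  (0 < n)%N -> extendable R (empty_graph n) -> ~~ odd n.
Proof.
move=> n_gt0 [lambda [[eig_l max_l]]] [m [S' [[symS' _ offS'] [_ max_S']]]].
move=> [lt_nm [f [inj_f sub_f]]].
have [eig_n max_n] := largest_eigenvalue_empty R n_gt0.
have def_l : lambda = n%:R - 1 by apply/le_anti; rewrite max_n ?max_l.
pose v : 'rV[R]_m := \sum_i delta_mx 0 (f i).
have vS' k : (v *m S') 0 k = \sum_i S' (f i) k.
  by rewrite mulmx_suml summxE; apply: eq_bigr => i _; rewrite -rowE mxE.
have mulvT (w : 'rV[R]_m) : (w *m v^T) 0 0 = \sum_i w 0 (f i).
  rewrite /v linear_sum mulmx_sumr summxE.
  by apply: eq_bigr => i _; rewrite /= trmx_delta -colE mxE.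
have v_f i : v 0 (f i) = 1.
  rewrite summxE (bigD1 i) //= mxE !eqxx big1 ?addr0 // => j neq_ji.
  by rewrite mxE (inj_eq inj_f) eq_sym (negPf neq_ji).
have S'_f i j : S' (f i) (f j) = 1 - (i == j)%:R.
  have /matrixP/(_ i j) := sub_f; rewrite seidel_emptyE !mxE => <-.
  by rewrite eq_sym.
(* Both sides are n (n - 1): on the left, each of the n rows of J - I sums to
   n - 1. *)
have form : v *m S' *m v^T = lambda *: (v *m v^T).
  apply/matrixP => i j; rewrite !ord1 [RHS]mxE !mulvT.
  under eq_bigr => k _.
    rewrite vS'; under eq_bigr do rewrite S'_f.
    rewrite sumrB sumr_const card_ord (bigD1 k) //= eqxx big1 ?addr0; last first.
      by move=> l /negPf ->.
    over.
  under [in RHS]eq_bigr do rewrite v_f.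
  by rewrite !sumr_const card_ord def_l mulr_natr.
have eig_v := rayleigh_eq_eigenvector symS' max_S' form.
(* Such an index exists because the principal submatrix is proper. *)
have [k k_out] : exists k, k \notin codom f.
  apply/existsP; rewrite -negb_forall; apply: contraL lt_nm => /forallP all_f.
  rewrite -leqNgt -(card_ord n) -(card_codom inj_f) -[leqLHS]card_ord.
  by apply/subset_leq_card/subsetP.
apply: (@sum_pm1_eq0_even R n (fun i => S' (f i) k)) => [i|].
  apply: offS'; apply: contraNneq k_out => <-; exact: codom_f.
rewrite -vS' eig_v mxE [v 0 k]summxE big1 ?mulr0 // => i _.
rewrite mxE /=; case: eqP => // eq_k; case/negP: k_out.
by rewrite eq_k codom_f.
Qed.

Theorem proposition6p8 (R : rcfType) (n : nat) (hn : (0 < n)%N) :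
  extendable R (empty_graph n) <-> ~~ odd n.
Proof. by split; [exact: extendable_even | exact: even_extendable]. Qed.
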